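(* For every $n\ge 1$, the number of permutation tableaux $T$ of length $n$ with $\mathrm{inv}(T)=0$ equals the Bell number $B_n$, the number of set partitions of $[n]$.
   Context: Permutation tableaux. Draw a Ferrers diagram in English convention: rows are left-justified, row lengths weakly decrease from top to bottom, and every column is nonempty. Rows of length zero are allowed. A permutation tableau $T$ is a filling of the cells of such a diagram with 0's and 1's satisfying two conditions: (i) every column contains at least one 1; (ii) no cell containing 0 has both a 1 above it in its column and a 1 to its left in its row. Its length $n$ is the number of rows plus the number of columns. Labels. The southeast boundary path of $n$ unit south/west steps, from the top-right corner to the bottom-left corner, has its steps labeled $1,\ldots,n$ in order. Each row gets the label of its south step (at the right end of the row), and each column the label of its west step. $(i,j)$ denotes the cell in row $i$ and column $j$. Zeros, ones and rows. A 1 is topmost if there is no 1 above it in its column. A 0 is restricted if there is a 1 above it in its column. A rightmost restricted 0 is a restricted 0 with no restricted 0 to its right in its row. A row is unrestricted if it contains no restricted 0; empty rows are unrestricted. Dots. Black dots are placed on the topmost 1's (one per column), each labeled by its column label. White dots are placed on the rightmost restricted 0's (one per restricted row), each labeled by its row label. Alternating paths. An alternating path is a sequence of dots, identified with the sequence of their labels, built as follows. - From a white dot in cell $(i,j)$, the next dot is the black dot of column $j$. - From a black dot in cell $(i,j)$: if row $i$ is unrestricted, the path ends; otherwise the next dot is the white dot of row $i$. - If $k$ is a column label or the label of a restricted row, $P_k$ is the path starting at the dot labeled $k$. - If $r$ is the label of an unrestricted row, $P_r$ is the empty path. $P_k$ is contained in a path $P$ if $k$ labels a dot of $P$. Empty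 paths are contained in no path. Order on paths. Let $P_a,P_b$ be two paths, neither contained in the other. Remove their longest common final segment, obtaining $P'_a,P'_b$. The ending position of $P'_a$ is defined as follows: - if $P'_a$ is nonempty, it is the cell of its last dot; - if $P_a$ is the empty path of an unrestricted row $r$, it is a point at the right end of row $r$, strictly to the right of all its cells. $P_a>P_b$ if the ending position of $P'_a$ is in a strictly lower row than that of $P'_b$, or in the same row and strictly to the right. Otherwise $P_a<P_b$. Inversions. An inversion is a pair $(j,k)$ of labels satisfying all of the following: $j$ is a column label; $j<k$; $k$ is not the label of a dot of $P_j$; and $P_j>P_k$. $\mathrm{inv}(T)$ is the number of inversions. *)

(* Defs.v *)
From mathcomp Require Import all_boot.
Set Implicit Arguments. Unset Strict Implicit. Unset Printing Implicit Defensive.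

(* Labels 1..n of the paper are represented by 0..n-1 (order preserving). *)

(* A candidate tableau of length n: the boundary path (step k is a south
   step, i.e. label k is a row, iff the k-th bit is true) and a 0/1 filling
   indexed by (row label, column label). *)
Definition tab (n : nat) := (n.-tuple bool * {ffun 'I_n * 'I_n -> bool})%type.

Section Tableau.
Variables (n : nat) (T : tab n).

Definition isrow (i : nat) : bool := (i < n) && nth false T.1 i.
Definition iscol (j : nat) : bool := (j < n) && ~~ nth false T.1 j.

(* cell in row i and column j exists iff the south step i comes before the
   west step j on the boundary path *)
Definition cell (i j : nat) : bool := [&& isrow i, iscol j & i < j].

Definition fl (i j : nat) : bool :=
  [exists a : 'I_n, [exists b : 'I_n, [&& val a == i, val b == j & T.2 (a, b)]]].

Definition one (i j : nat) : bool := cell i j && fl i j.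

(* rows above row i = rows with smaller label; columns to the left of
   column j = columns with larger label *)
Definition one_above (i j : nat) : bool := has (fun i' => one i' j) (iota 0 i).
Definition one_left (i j : nat) : bool :=
  has (fun j' => (j < j') && one i j') (iota 0 n).

Definition is_perm_tableau : bool :=
  [&& (* filling vanishes outside the diagram (canonical representative) *)
      [forall a : 'I_n, forall b : 'I_n, ~~ cell a b ==> ~~ T.2 (a, b)],
      [forall j : 'I_n, iscol j ==> has (fun i => cell i j) (iota 0 n)],
      [forall j : 'I_n, iscol j ==> has (fun i => one i j) (iota 0 n)] &
      [forall a : 'I_n, forall b : 'I_n,
         (cell a b && ~~ fl a b) ==> ~~ (one_above a b && one_left a b)]].

Definition top (j : nat) : nat := find (fun i => one i j) (iota 0 n).

Definition restr0 (i j : nat) : bool := [&& cell i j, ~~ fl i j & one_above i j].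

Definition restricted_row (i : nat) : bool := isrow i && has (restr0 i) (iota 0 n).

(* column of the rightmost restricted 0 of row i (white dot): the rightmost
   column is the one with smallest label *)
Definition wcol (i : nat) : nat := find (restr0 i) (iota 0 n).

Definition dotcell (x : nat) : nat * nat :=
  if iscol x then (top x, x) else (x, wcol x).

Definition next_dot (x : nat) : option nat :=
  if iscol x then (if restricted_row (top x) then Some (top x) else None)
  else Some (wcol x).

Fixpoint trace (fuel : nat) (x : nat) : seq nat :=
  x :: match fuel with
       | 0 => [::]
       | f.+1 => if next_dot x is Some y then trace f y else [::]
       end.

(* P_k as the sequence of labels of its dots (labels are distinct, so at
   most n dots: fuel n is never exhausted) *)
Definition alt_path (k : nat) : seq nat :=
  if iscol k || restricted_row k then trace n k else [::].

Definition contained (a b : nat) : bool := (alt_path a != [::]) && (a \in alt_path b).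

Fixpoint drop_common (s t : seq nat) : seq nat * seq nat :=
  match s, t with
  | x :: s', y :: t' => if x == y then drop_common s' t' else (s, t)
  | _, _ => (s, t)
  end.

(* position: (row, Some column label) for a cell, (row, None) for the point
   at the right end of an (unrestricted) row *)
Definition endpos (a : nat) (ra : seq nat) : option (nat * option nat) :=
  match ra with
  | x :: _ => Some ((dotcell x).1, Some (dotcell x).2)
  | [::] => if alt_path a == [::] then Some (a, None) else None
  end.

Definition right_of (x y : option nat) : bool :=
  match x, y with
  | Some c1, Some c2 => c1 < c2
  | None, Some _ => true
  | _, None => false
  end.

Definition pos_gt (p q : nat * option nat) : bool :=
  (p.1 > q.1) || ((p.1 == q.1) && right_of p.2 q.2).

Definition path_gt (a b : nat) : bool :=
  let rs := drop_common (rev (alt_path a)) (rev (alt_path b)) in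
  [&& ~~ contained a b, ~~ contained b a &
      match endpos a rs.1, endpos b rs.2 with
      | Some p, Some q => pos_gt p q
      | _, _ => false
      end].

Definition inversion (j k : nat) : bool :=
  [&& iscol j, j < k, k < n, k \notin alt_path j & path_gt j k].

Definition pt_inv : nat :=
  \sum_(j < n) \sum_(k < n) inversion j k.

End Tableau.

Definition bell (n : nat) : nat :=
  #|[set P : {set {set 'I_n}} | partition P [set: 'I_n]]|.

(* Main.v *)
(** A permutation tableau has no inversion iff every topmost 1 is the leftmost
    1 of its row.  If this fails, take a topmost 1 in cell [(i, j)] with a 1 in
    [(i, k)] to its left and [i] minimal: above row [i] paths do not cross, so
    [P_j > P_k].  If it holds, a path started further left along the boundary
    stays below, by induction on the rows.

    Such a tableau is determined by the map [f] sending a row to the column of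
    its leftmost 1 (rows of 0's and columns are fixed): the condition on 0's
    forces cell [(i, j)] to contain 1 exactly when [j <= f i] and some row
    [k <= i] has [f k = j].  The maps that occur are those with [i <= f i] and
    [f (f i) = f i], that is, the maps sending each element to the maximum of
    its block in a set partition. *)
From mathcomp Require Import zify.
Require Import Defs.
From mathcomp Require Import all_boot.
Set Implicit Arguments. Unset Strict Implicit. Unset Printing Implicit Defensive.

(* [all_boot] has another [one]. *)
Local Notation one := Defs.one.

(** * First hits in an initial segment of the naturals *)

Section FindIota.
Variables (p : pred nat) (n : nat).

Lemma find_iota_min i : p i -> find p (iota 0 n) <= i.
Proof.
move=> pi; rewrite leqNgt; apply/negP => lti.
have := before_find 0 lti; rewrite nth_iota ?add0n ?pi //.
by apply: leq_trans lti _; rewrite -[X in _ <= X](size_iota 0 n) find_size.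
Qed.

Lemma find_iotaP : has p (iota 0 n) -> p (find p (iota 0 n)).
Proof.
move=> hp; have := nth_find 0 hp; rewrite nth_iota ?add0n //.
by rewrite -[X in _ < X](size_iota 0 n) -has_find.
Qed.

Lemma has_iota : reflect (exists2 i, i < n & p i) (has p (iota 0 n)).
Proof.
by apply: (iffP hasP) => -[i]; rewrite ?mem_iota => ? ?; exists i; rewrite ?mem_iota.
Qed.

End FindIota.

Lemma drop_common_cat (w s t : seq nat) (x y : nat) :
  x != y -> drop_common (w ++ x :: s) (w ++ y :: t) = (x :: s, y :: t).
Proof. by move=> /negPf nxy; elim: w => [|z w IH] /=; rewrite ?nxy ?eqxx. Qed.

(** * Topmost ones and restricted zeros of a tableau *)

Section Tableau.
Variables (n : nat) (T : tab n).
Implicit Types (a b c i j k x y : nat).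

Definition leading_tops : bool :=
  [forall j : 'I_n, forall k : 'I_n,
     iscol T j && (j < k) ==> ~~ one T (top T j) k].

(** Restricted to rows above [b], because in a minimal counterexample only those rows are under
    control. *)
Definition leading_tops_above b : Prop :=
  forall j k, iscol T j -> top T j < b -> j < k -> ~~ one T (top T j) k.

Hypothesis ptT : is_perm_tableau T.

Lemma isrow_lt i : isrow T i -> i < n. Proof. by case/andP. Qed.
Lemma iscol_lt j : iscol T j -> j < n. Proof. by case/andP. Qed.

Lemma iscolN i : isrow T i -> iscol T i = false.
Proof. by rewrite /isrow /iscol => /andP[-> ->]. Qed.

Lemma one_cell i j : one T i j -> [/\ isrow T i, iscol T j & i < j].
Proof. by case/andP => /and3P. Qed.

Lemma leading_topsP b : leading_tops -> leading_tops_above b.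
Proof.
move=> /forallP lt j k cj _ jk; apply/negP => o.
have [_ ck _] := one_cell o.
have /forallP/(_ (Ordinal (iscol_lt ck))) := lt (Ordinal (iscol_lt cj)).
by rewrite /= cj jk o.
Qed.

Lemma top_one j : iscol T j -> one T (top T j) j.
Proof.
move=> cj; case/and4P: ptT => _ _ /forallP/(_ (Ordinal (iscol_lt cj))) + _.
by rewrite /= cj => /find_iotaP.
Qed.

Lemma top_min i j : one T i j -> top T j <= i.
Proof. exact: (@find_iota_min (fun i => one T i j)). Qed.

Lemma top_row j : iscol T j -> isrow T (top T j).
Proof. by case/top_one/one_cell. Qed.

Lemma top_lt j : iscol T j -> top T j < j.
Proof. by case/top_one/one_cell. Qed.

Lemma cell_below_top i j : cell T i j -> top T j < i -> one T i j || restr0 T i j.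
Proof.
move=> cij ti; rewrite /one /restr0 cij /=; case: fl => //=.
have [_ cj _] := and3P cij.
by apply/has_iota; exists (top T j); rewrite ?top_one.
Qed.

(** Condition (ii): a restricted 0 has a 1 above it, hence no 1 to its left, and left means larger
    label. *)
Lemma restr0_lt i j k : restr0 T i j -> one T i k -> k < j.
Proof.
move=> /and3P[cij nf ab] o; have [ri ck ik] := one_cell o.
have [_ cj _] := and3P cij.
case: (ltngtP k j) => // [jk|E]; last by move: o; rewrite E /one (negPf nf) andbF.
case/and4P: ptT => _ _ _ /forallP/(_ (Ordinal (isrow_lt ri))).
move=> /forallP/(_ (Ordinal (iscol_lt cj))) /=; rewrite cij nf ab /=.
by move/negP; case; apply/has_iota; exists k; rewrite ?iscol_lt ?jk.
Qed.

Lemma wcolP i : restricted_row T i -> restr0 T i (wcol T i).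
Proof. by case/andP => _ /find_iotaP. Qed.

Lemma restr0_wcol i j : restr0 T i j -> restricted_row T i /\ wcol T i <= j.
Proof.
move=> r; split; last exact: find_iota_min.
have /and3P[/and3P[ri cj _] _ _] := r.
by rewrite /restricted_row ri; apply/has_iota; exists j; rewrite ?iscol_lt.
Qed.

Lemma restricted_isrow i : restricted_row T i -> isrow T i.
Proof. by case/andP. Qed.

Lemma wcol_col i : restricted_row T i -> iscol T (wcol T i).
Proof. by case/wcolP/and3P => /and3P[]. Qed.

Lemma wcol_gt i : restricted_row T i -> i < wcol T i.
Proof. by case/wcolP/and3P => /and3P[]. Qed.

Lemma top_wcol i : restricted_row T i -> top T (wcol T i) < i.
Proof.
by case/wcolP/and3P => _ _ /has_iota[k ki /top_min tk]; apply: leq_ltn_trans tk ki.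
Qed.

Lemma one_wcol i j : restricted_row T i -> one T i j -> j < wcol T i.
Proof. by move=> /wcolP; apply: restr0_lt. Qed.

(** * Dots and alternating paths *)

Definition is_dot x := iscol T x || restricted_row T x.

Lemma dotcell_col j : iscol T j -> dotcell T j = (top T j, j).
Proof. by rewrite /dotcell => ->. Qed.

Lemma dotcell_row i : restricted_row T i -> dotcell T i = (i, wcol T i).
Proof. by rewrite /dotcell => /restricted_isrow/iscolN->. Qed.

(** A black dot is followed by a dot strictly to its left in the same row, a white dot by one
    strictly above in the same column. The last inequality is the strict decrease of row minus
    column, without subtraction. *)
Lemma next_dotP x y : is_dot x -> next_dot T x = Some y ->
  [/\ is_dot y, (dotcell T y).1 <= (dotcell T x).1,
      (dotcell T x).2 <= (dotcell T y).2
    & (dotcell T y).1 + (dotcell T x).2 < (dotcell T x).1 + (dotcell T y).2].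
Proof.
rewrite /is_dot /next_dot; case: (boolP (iscol T x)) => [cx _|ncx /= rx].
  case: ifP => // rt [<-]; rewrite rt orbT (dotcell_col cx) (dotcell_row rt) /=.
  by have := one_wcol rt (top_one cx); split=> //; lia.
case=> <-; rewrite (dotcell_row rx) (dotcell_col (wcol_col rx)) wcol_col //=.
by have := top_wcol rx; split=> //; lia.
Qed.

(* Strictly decreases along a path and is less than [n], so that the fuel of
   [trace] suffices. *)
Definition dot_height x := (dotcell T x).1 + n - (dotcell T x).2.

Lemma dotcell_lt x : is_dot x -> (dotcell T x).1 < (dotcell T x).2 < n.
Proof.
case/orP => [cx|rx].
  by rewrite dotcell_col // top_lt ?iscol_lt.
by rewrite dotcell_row //= wcol_gt ?iscol_lt ?wcol_col.
Qed.

Lemma trace_fuel x f g : is_dot x -> dot_height x <= f -> dot_height x <= g ->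
  trace T f x = trace T g x.
Proof.
elim: f g x => [|f IH] [|g] x dx hf hg //=.
(* Zero fuel cannot occur: the column of a dot is below [n], so its height is positive. *)
- by have := dotcell_lt dx; move: hf; rewrite /dot_height; lia.
- by have := dotcell_lt dx; move: hg; rewrite /dot_height; lia.
case E: next_dot => [y|] //; congr cons.
have [dy _ _ lt] := next_dotP dx E.
have := dotcell_lt dx; have := dotcell_lt dy.
by move: hf hg; rewrite /dot_height => *; apply: IH => //; rewrite /dot_height; lia.
Qed.

Lemma alt_path_next x : is_dot x ->
  alt_path T x = x :: (if next_dot T x is Some y then alt_path T y else [::]).
Proof.
move=> dx; rewrite /alt_path -/(is_dot x) dx.
have ltx := dotcell_lt dx.
have n0 : 0 < n by lia.
have trS f : 0 < f ->
    trace T f x = x :: (if next_dot T x is Some y then trace T f.-1 y else [::]).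
  by case: f.
rewrite trS //; congr cons; case E: next_dot => [y|] //.
have [dy _ _ lt] := next_dotP dx E; have lty := dotcell_lt dy.
(* Fuel [n.-1] still suffices for the tail, since the row label of a dot is below its column
   label. *)
rewrite -/(is_dot y) dy; apply: trace_fuel; rewrite // /dot_height; lia.
Qed.

Lemma alt_path_col j : iscol T j -> alt_path T j = j :: alt_path T (top T j).
Proof.
move=> cj; rewrite alt_path_next /is_dot ?cj // /next_dot cj.
have [rt|nr] := boolP (restricted_row T _) => //.
by rewrite /alt_path iscolN ?top_row // (negPf nr).
Qed.

Lemma alt_path_row i : restricted_row T i ->
  alt_path T i = i :: alt_path T (wcol T i).
Proof.
move=> ri; rewrite alt_path_next /is_dot ?ri ?orbT // /next_dot.
by rewrite iscolN ?restricted_isrow.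
Qed.

Lemma alt_path_unrestricted i : isrow T i -> ~~ restricted_row T i -> alt_path T i = [::].
Proof. by move=> ri /negPf nr; rewrite /alt_path iscolN // nr. Qed.

(** Paths run weakly up and to the left; this rules out containments. *)
Lemma alt_path_dotcell x y : y \in alt_path T x ->
  (dotcell T y).1 <= (dotcell T x).1 /\ (dotcell T x).2 <= (dotcell T y).2.
Proof.
case dx: (is_dot x); last by rewrite /alt_path -/(is_dot x) dx.
have [m] := ubnP (dot_height x); elim: m => // m IH in x dx * => hm.
rewrite alt_path_next // inE => /predU1P[-> //|].
case E: next_dot => [z|] // yz.
have [dz r c lt] := next_dotP dx E; have := dotcell_lt dx; have := dotcell_lt dz => ? ?.
have [|r' c'] := IH z dz _ yz; first by move: hm; rewrite /dot_height; lia.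
by split; [apply: leq_trans r' r | apply: leq_trans c c'].
Qed.

(** A white dot always has a successor, so a path ends on a black dot; each passage through a white
    dot leads to a strictly higher row, which drives the induction. *)
Lemma alt_path_last j : iscol T j ->
  exists u e, [/\ alt_path T j = u ++ [:: e], iscol T e & top T e <= top T j].
Proof.
have [m] := ubnP (top T j); elim: m => // m IH in j * => hm cj.
have [rt|nrt] := boolP (restricted_row T (top T j)).
  have tw := top_wcol rt.
  have [||u [e [E ce le]]] := IH (wcol T (top T j)); rewrite ?wcol_col //.
    by apply: leq_trans tw _; rewrite -ltnS.
  exists [:: j, top T j & u], e; split=> //.
    by rewrite alt_path_col // alt_path_row // E.
  exact: leq_trans le (ltnW tw).
exists [::], j; split=> //.
by rewrite alt_path_col // alt_path_unrestricted ?top_row.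
Qed.

(** * Comparison of paths *)

Definition dotpos x : nat * option nat := ((dotcell T x).1, Some (dotcell T x).2).

(* Paths are compared at the dots [x] and [y] where their common final
   segment [w] starts; [y] is below [x], or to its right in the same row. *)
Definition path_above (s t : seq nat) : Prop :=
  exists u x v y w,
    [/\ s = u ++ x :: w, t = v ++ y :: w & pos_gt (dotpos y) (dotpos x)].

Lemma path_above_cat p q s t : path_above s t -> path_above (p ++ s) (q ++ t).
Proof.
case=> u [x [v [y [w [-> -> yx]]]]].
by exists (p ++ u), x, (q ++ v), y, w; rewrite !catA.
Qed.

Lemma pos_gt_asym (p q : nat * option nat) : pos_gt p q -> ~~ pos_gt q p.
Proof.
by case: p q => [a [b|]] [c [d|]]; rewrite /pos_gt /=; lia.
Qed.

(** Reversal turns the common final segment into a prefix, which [drop_common] strips up to the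
    differing dots [x] and [y]; these decide the order. *)
Lemma path_above_gt a b : path_above (alt_path T a) (alt_path T b) ->
  ~~ path_gt T a b /\
  (~~ contained T a b -> ~~ contained T b a -> path_gt T b a).
Proof.
case=> u [x [v [y [w [Ea Eb yx]]]]].
have nxy : x != y.
  by apply: contraTneq yx => ->; apply/negP => yy; have := pos_gt_asym yy; rewrite yy.
have Er s z : rev (s ++ z :: w) = rev w ++ z :: rev s.
  by rewrite rev_cat rev_cons cat_rcons.
rewrite /path_gt Ea Eb !Er !drop_common_cat //=; last by rewrite eq_sym.
rewrite -!/(dotpos _) yx (negPf (pos_gt_asym yx)) !andbF; split=> //.
by move=> -> ->.
Qed.

(** * Leading topmost ones exclude inversions *)

Lemma leading_tops_above_le b b' : b' <= b ->
  leading_tops_above b -> leading_tops_above b'.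
Proof. by move=> lb lt j k cj tj; apply: lt => //; apply: leq_trans tj lb. Qed.

(** Of two topmost ones in the same row, the right one would have a 1 to its left. *)
Lemma top_inj_above b j k : leading_tops_above b -> iscol T j -> iscol T k ->
  top T j < b -> top T j = top T k -> j = k.
Proof.
move=> lt cj ck tj E; case: (ltngtP j k) => // h; exfalso.
  by have := lt j k cj tj h; rewrite E top_one.
by move: tj; rewrite E => tk; have := lt k j ck tk h; rewrite -E top_one.
Qed.

(** The path of [k] is a single dot, and the path of [j] ends strictly above it. *)
Lemma last_above j k : iscol T j -> iscol T k -> top T j < top T k ->
  ~~ restricted_row T (top T k) -> path_above (alt_path T j) (alt_path T k).
Proof.
move=> cj ck lt nr; have [u [e [-> ce le]]] := alt_path_last cj.
rewrite (alt_path_col ck) alt_path_unrestricted ?top_row //.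
exists u, e, [::], k, [::]; split=> //.
by rewrite /pos_gt /dotpos !dotcell_col //= (leq_ltn_trans le lt).
Qed.

(** Paths do not cross: with [c] the column of the white dot of row [b], the path through the lower
    of the black dots of [j] and [c] is advanced. The hypotheses persist until both paths enter one
    column or the lower one ends. *)
Lemma path_above_row j b : leading_tops_above b -> iscol T j ->
  restricted_row T b -> top T j < b -> j < wcol T b ->
  path_above (alt_path T j) (alt_path T b).
Proof.
have [m] := ubnP (top T j + b); elim: m => // m IH in j b * => hm lt cj rb tj jc.
have cc := wcol_col rb; have tc := top_wcol rb.
set c := wcol T b in jc cc tc.
have Eb : alt_path T b = b :: alt_path T c by rewrite alt_path_row.
case: (ltngtP (top T j) (top T c)) => h; last first.
- by have := top_inj_above lt cj cc tj h; lia.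
(* Column [c] has a 1 above row [top T j], whose leftmost 1 is in column [j]; so this cell is a
   restricted 0. *)
- have cjc : cell T (top T j) c.
    by rewrite /cell top_row // cc (ltn_trans (top_lt cj) jc).
  have := cell_below_top cjc h; rewrite (negPf (lt _ _ cj tj jc)) /= => r0.
  have [rt wc] := restr0_wcol r0.
  rewrite (alt_path_col cj) (alt_path_row rt).
  move: wc; rewrite leq_eqVlt => /predU1P[E|wc].
    rewrite E Eb; exists [:: j], (top T j), [::], b, (alt_path T c); split=> //.
    by rewrite /pos_gt /dotpos !dotcell_row //= tj.
  have tw := top_wcol rt.
  apply: (path_above_cat [:: j; top T j] [::]); apply: IH => //; last by lia.
    by lia.
  exact: wcol_col.
(* Now the black dot of [c] is the lower one, and row [top T c] takes the place of [b]. *)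
rewrite Eb; apply: (path_above_cat [::] [:: b]).
have [rt|nr] := boolP (restricted_row T (top T c)); last exact: last_above.
rewrite (alt_path_col cc); apply: (path_above_cat [::] [:: c]).
apply: IH => //; [by lia | exact: leading_tops_above_le (ltnW tc) lt |].
exact: ltn_trans jc (one_wcol rt (top_one cc)).
Qed.

(** The same advance of the lower dot. Meeting in column [k] is excluded by [k \notin alt_path T j];
    once the dot of [k] is the lower one, its row falls under [path_above_row]. *)
Lemma path_above_col j k : leading_tops -> iscol T j -> iscol T k -> j < k ->
  k \notin alt_path T j -> path_above (alt_path T j) (alt_path T k).
Proof.
move=> lt; have [m] := ubnP (top T j); elim: m => // m IH in j * => hm cj ck jk nk.
case: (ltngtP (top T j) (top T k)) => h; last first.
- by have := top_inj_above (leading_topsP lt) cj ck (ltnSn _) h; lia.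
- have cjk : cell T (top T j) k.
    by rewrite /cell top_row // ck (ltn_trans (top_lt cj) jk).
  have := cell_below_top cjk h.
  rewrite (negPf (leading_topsP lt cj (ltnSn _) jk)) /= => /restr0_wcol[rt wc].
  move: nk; rewrite (alt_path_col cj) (alt_path_row rt) !inE !negb_or.
  case/and3P=> _ _ nk; apply: (path_above_cat [:: j; top T j] [::]).
  have tw := top_wcol rt; have cw := wcol_col rt.
  apply: IH => //; first by lia.
  rewrite ltn_neqAle wc andbT; apply: contraNneq nk => <-.
  by rewrite alt_path_col // mem_head.
have [rt|nr] := boolP (restricted_row T (top T k)); last exact: last_above.
rewrite (alt_path_col ck); apply: (path_above_cat [::] [:: k]).
apply: path_above_row => //; first exact: leading_topsP.
exact: ltn_trans jk (one_wcol rt (top_one ck)).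
Qed.

Lemma leading_tops_no_inversion j k : leading_tops -> ~~ inversion T j k.
Proof.
move=> lt; apply/negP => /and5P[cj jk kn nk].
apply/negP; case ck: (iscol T k).
  by have [] := path_above_gt (path_above_col lt cj ck jk nk).
have rk : isrow T k by move: ck; rewrite /isrow /iscol kn /= => /negbFE.
have tk := ltn_trans (top_lt cj) jk.
have [rr|nr] := boolP (restricted_row T k).
  have [] // := path_above_gt (path_above_row (leading_topsP lt) cj rr tk _).
  exact: ltn_trans jk (wcol_gt rr).
(* The path of an unrestricted row [k] is empty and ends in row [k], below every dot of the path of
   [j]. *)
rewrite /path_gt /endpos [alt_path T k](alt_path_unrestricted rk nr) /=.
have -> s : drop_common s [::] = (s, [::]) by case: s.
case E: rev => [|x s] /=; first by rewrite alt_path_col //= !andbF.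
have /alt_path_dotcell[] : x \in alt_path T j by rewrite -mem_rev E mem_head.
rewrite (dotcell_col cj) /= => le _; rewrite /pos_gt /=.
by have := leq_ltn_trans le tk => {}le; rewrite ltnNge (ltnW le) (ltn_eqF le) !andbF.
Qed.

(** * Inversions from topmost ones that are not leading *)

Lemma inversion_of_above j k : iscol T j -> j < k < n ->
  ~~ contained T j k -> ~~ contained T k j ->
  path_above (alt_path T k) (alt_path T j) -> inversion T j k.
Proof.
move=> cj /andP[jk kn] njk nkj pa; rewrite /inversion cj jk kn /=.
have [_ -> //] := path_above_gt pa; rewrite andbT.
(* [contained] also asks for a nonempty path of [k]; [path_above] guarantees it. *)
move: nkj; rewrite /contained negb_and negbK => /orP[/eqP E|] //.
case: pa => u [x [v [y [w []]]]]; rewrite E.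
by case: u.
Qed.

(** After [j], its path stays left of column [k], as the white dot of a row lies left of all its
    ones; the path of [k] never returns right to [j]. If both topmost ones share a row, the tails
    agree and [j] is to the right; otherwise paths do not cross above that row. *)
Lemma inversion_of_left_one j k : iscol T j -> j < k -> one T (top T j) k ->
  leading_tops_above (top T j) -> inversion T j k.
Proof.
move=> cj jk o lt; have [ri ck ik] := one_cell o.
have nkj : k \notin alt_path T j.
  rewrite alt_path_col // inE negb_or gtn_eqF //=.
  have [rt|nr] := boolP (restricted_row T (top T j));
    last by rewrite alt_path_unrestricted.
  apply/negP => /alt_path_dotcell[_]; rewrite dotcell_row // dotcell_col //=.
  by rewrite leqNgt one_wcol.
have njk : j \notin alt_path T k.
  by apply/negP => /alt_path_dotcell[_]; rewrite !dotcell_col //= leqNgt jk.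
apply: inversion_of_above; rewrite /contained ?negb_and ?njk ?nkj ?orbT //.
  by rewrite jk iscol_lt.
have := top_min o; rewrite leq_eqVlt => /predU1P[E|tk].
  rewrite (alt_path_col ck) (alt_path_col cj) E.
  exists [::], k, [::], j, (alt_path T (top T j)); split=> //.
  by rewrite /pos_gt /dotpos !dotcell_col //= E eqxx jk orbT.
have [rt|nr] := boolP (restricted_row T (top T j)); last exact: last_above.
rewrite (alt_path_col cj); apply: (path_above_cat [::] [:: j]).
by apply: path_above_row => //; apply: one_wcol.
Qed.

Lemma no_inversion_leading_tops :
  (forall j k, ~~ inversion T j k) -> leading_tops.
Proof.
move=> ni; have lt b : leading_tops_above b.
  (* The induction plays the role of a minimal counterexample. *)
  elim: b => [|b IH] j k cj //; rewrite ltnS => tb jk; apply/negP => o.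
  have := ni j k; rewrite inversion_of_left_one //.
  exact: leading_tops_above_le tb IH.
apply/forallP => j; apply/forallP => k; apply/implyP => /andP[cj jk].
exact: lt cj (ltnSn _) jk.
Qed.

Lemma pt_inv_eq0 : (pt_inv T == 0) = leading_tops.
Proof.
rewrite /pt_inv sum_nat_eq0; apply/idP/idP => [/forallP ni|lt].
  apply: no_inversion_leading_tops => j k; apply/negP => ijk.
  have /and5P[cj _ kn _ _] := ijk.
  have /implyP/(_ isT) := ni (Ordinal (iscol_lt cj)).
  rewrite sum_nat_eq0 => /forallP/(_ (Ordinal kn)) /=.
  by rewrite ijk.
apply/forallP => j /=; rewrite sum_nat_eq0; apply/forallP => k /=.
by rewrite eqb0 leading_tops_no_inversion.
Qed.

End Tableau.

(** * Tableaux encoded by maps *)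

Definition closure_map n (f : {ffun 'I_n -> 'I_n}) : bool :=
  [forall i : 'I_n, (i <= f i) && (f (f i) == f i)].

(** Columns are the maxima of blocks with at least two elements; a singleton block becomes a row of
    zeros. *)
Definition tab_of_map n (f : {ffun 'I_n -> 'I_n}) : tab n :=
  ([tuple [forall k : 'I_n, (k < i) ==> (f k != i)] | i < n],
   [ffun c : 'I_n * 'I_n =>
      (c.1 < c.2 <= f c.1) && [exists k : 'I_n, (k <= c.1) && (f k == c.2)]]).

(** Leftmost means largest label; the default [i] fixes columns and rows without ones. *)
Definition map_of_tab n (T : tab n) : {ffun 'I_n -> 'I_n} :=
  [ffun i : 'I_n => [arg max_(j > i | (j == i) || one T i j) nat_of_ord j]].

Lemma closure_mapP n (f : {ffun 'I_n -> 'I_n}) :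
  reflect ((forall i : 'I_n, i <= f i) /\ (forall i, f (f i) = f i)) (closure_map f).
Proof.
apply: (iffP forallP) => [h|[h1 h2] i]; last by rewrite h1 h2 eqxx.
by split=> i; have /andP[? /eqP] := h i.
Qed.

Lemma fl_ord n (T : tab n) (a b : 'I_n) : fl T a b = T.2 (a, b).
Proof.
apply/existsP/idP => [[a' /existsP[b' /and3P[/eqP/val_inj-> /eqP/val_inj-> //]]]|h].
by exists a; apply/existsP; exists b; rewrite !eqxx.
Qed.

Section TabOfMap.
Variables (n : nat) (f : {ffun 'I_n -> 'I_n}).
Hypothesis cf : closure_map f.
Implicit Types i j k : 'I_n.
Let T := tab_of_map f.

Let f_ge i : i <= f i. Proof. by case/closure_mapP: cf. Qed.
Let f_idem i : f (f i) = f i. Proof. by case/closure_mapP: cf. Qed.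

Lemma isrow_tab_of_map i : isrow T i = [forall k : 'I_n, (k < i) ==> (f k != i)].
Proof. by rewrite /isrow ltn_ord -(tnth_nth false T.1) tnth_mktuple. Qed.

Lemma iscol_tab_of_map i : iscol T i = [exists k : 'I_n, (k < i) && (f k == i)].
Proof.
rewrite /iscol ltn_ord -(tnth_nth false T.1) tnth_mktuple negb_forall.
by apply: eq_existsb => k; rewrite negb_imply negbK.
Qed.

Lemma fl_tab_of_map i j :
  fl T i j = (i < j <= f i) && [exists k : 'I_n, (k <= i) && (f k == j)].
Proof. by rewrite fl_ord ffunE. Qed.

Lemma fl_cell_tab_of_map i j : fl T i j -> cell T i j.
Proof.
rewrite fl_tab_of_map => /andP[/andP[ij jf] /existsP[k /andP[ki /eqP fk]]].
rewrite /cell ij andbT isrow_tab_of_map iscol_tab_of_map.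
apply/andP; split; last by apply/existsP; exists k; rewrite fk eqxx (leq_ltn_trans ki ij).
(* A 1 in row [i] forces [i < f i], so [i] is not a value of [f], whose values are fixed points. *)
apply/forallP => l; apply/implyP => _; apply: contraTneq (leq_trans ij jf) => fl.
by rewrite -fl f_idem ltnn.
Qed.

Lemma one_tab_of_map i j :
  one T i j = (i < j <= f i) && [exists k : 'I_n, (k <= i) && (f k == j)].
Proof.
rewrite -fl_tab_of_map /one; case E: fl; rewrite ?andbF ?andbT //.
exact: fl_cell_tab_of_map.
Qed.

Lemma one_map_tab_of_map i : i < f i -> one T i (f i).
Proof.
by move=> lt; rewrite one_tab_of_map lt leqnn; apply/existsP; exists i; rewrite leqnn /=.
Qed.

Lemma col_one_tab_of_map j : iscol T j -> exists2 k : 'I_n, one T k j & f k = j.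
Proof.
rewrite iscol_tab_of_map => /existsP[k /andP[kj /eqP fk]]; exists k => //.
by rewrite -fk one_map_tab_of_map // fk.
Qed.

Lemma is_perm_tab_of_map : is_perm_tableau T.
Proof.
have hasT (p : pred nat) (k : 'I_n) : p k -> has p (iota 0 n).
  by move=> pk; apply/has_iota; exists k.
apply/and4P; split.
- apply/forallP => a; apply/forallP => b; apply/implyP; apply: contra.
  by rewrite -fl_ord; apply: fl_cell_tab_of_map.
- apply/forallP => j; apply/implyP => /col_one_tab_of_map[k /andP[cj _] _].
  exact: (hasT (cell T ^~ j) k).
- apply/forallP => j; apply/implyP => /col_one_tab_of_map[k o _].
  exact: (hasT (one T ^~ j) k).
(* A 1 to the left gives [b <= f a], and a 1 above gives some [k <= a] with [f k = b]: together they
   put a 1 in the cell itself. *)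
apply/forallP => a; apply/forallP => b; apply/implyP => /andP[/and3P[_ _ ab]].
rewrite fl_tab_of_map ab /= => nf; apply/andP => -[/has_iota[i ia oi] /has_iota[j jn]].
case/andP=> bj; rewrite -[j]/(val (Ordinal jn)) one_tab_of_map.
case/andP=> /andP[_ /= jf] _; move/negP: nf; apply.
rewrite (leq_trans (ltnW bj) jf) /=.
move: oi; rewrite -[i]/(val (Ordinal (ltn_trans ia (ltn_ord a)))) one_tab_of_map /=.
case/andP=> _ /existsP[k /andP[/= ki fk]]; apply/existsP; exists k.
by rewrite fk (leq_trans ki (ltnW ia)).
Qed.

(** The row [k] with [f k = j] witnessing the topmost 1 of column [j] has itself a 1 there, so it is
    the top row; its ones reach no further left than [f k = j]. *)
Lemma leading_tops_tab_of_map : leading_tops T.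
Proof.
apply/forallP => j; apply/forallP => l; apply/implyP => /andP[cj jl].
have := top_one is_perm_tab_of_map cj.
have tn : top T j < n by apply: ltn_trans (top_lt is_perm_tab_of_map cj) _.
set t : 'I_n := Ordinal tn; rewrite -[top T j]/(val t) !one_tab_of_map.
case/andP=> /andP[tj jf] /existsP[k /andP[kt /eqP fk]].
have ok : one T k j by rewrite -fk one_map_tab_of_map // fk (leq_ltn_trans kt tj).
have kE : k = t by apply/val_inj/eqP; rewrite eqn_leq kt /=; apply: top_min ok.
by rewrite -kE fk (leqNgt l j) jl /= andbF.
Qed.

Lemma tab_of_mapK : map_of_tab T = f.
Proof.
apply/ffunP => i; rewrite ffunE; case: arg_maxnP => [|j]; first by rewrite eqxx.
move=> oj /(_ (f i)) max; apply/val_inj/eqP; rewrite eqn_leq; apply/andP; split.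
  case/orP: oj => [/eqP->|]; first exact: f_ge.
  by rewrite one_tab_of_map => /andP[/andP[]].
apply: max; have := f_ge i; rewrite leq_eqVlt => /predU1P[E|lt].
  by rewrite -val_eqE /= -E eqxx.
by rewrite one_map_tab_of_map // orbT.
Qed.

End TabOfMap.

(** * Recovering a tableau from its map *)

Section MapOfTab.
Variables (n : nat) (T : tab n).
Hypotheses (ptT : is_perm_tableau T) (lt : leading_tops T).
Implicit Types i j k : 'I_n.
Let f := map_of_tab T.

Lemma map_of_tab_one i : f i = i \/ one T i (f i).
Proof.
rewrite /f ffunE; case: arg_maxnP => [|j]; first by rewrite eqxx.
by case/orP=> [/eqP|]; [left | right].
Qed.

Lemma map_of_tab_max i j : one T i j -> j <= f i.
Proof.
move=> o; rewrite /f ffunE; case: arg_maxnP => [|k _]; first by rewrite eqxx.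
by apply; rewrite o orbT.
Qed.

Lemma map_of_tab_ge i : i <= f i.
Proof. by case: (map_of_tab_one i) => [->//|/one_cell[_ _ /ltnW]]. Qed.

Lemma map_of_tab_col j : iscol T j -> f j = j.
Proof.
by move=> cj; case: (map_of_tab_one j) => // /one_cell[/iscolN]; rewrite cj.
Qed.

Lemma closure_map_of_tab : closure_map f.
Proof.
apply/closure_mapP; split=> [|i]; first exact: map_of_tab_ge.
by case: (map_of_tab_one i) => [E|/one_cell[_ /map_of_tab_col]]; rewrite ?E.
Qed.

(** The topmost 1 of a column is the leftmost 1 of its row, so every column is attained by the map
    from its top row. *)
Lemma map_of_tab_top j : iscol T j -> exists2 k, f k = j & val k = top T j.
Proof.
move=> cj; have tn := ltn_trans (top_lt ptT cj) (ltn_ord j).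
exists (Ordinal tn) => //; apply/val_inj/eqP; rewrite /= eqn_leq.
rewrite map_of_tab_max ?top_one // andbT leqNgt; apply/negP => jf.
case: (map_of_tab_one (Ordinal tn)) => [E|].
  by move: jf; rewrite E /= ltnNge (ltnW (top_lt ptT cj)).
by apply/negP; apply: (leading_topsP lt cj (ltnSn _) jf).
Qed.

Lemma map_of_tabK : tab_of_map f = T.
Proof.
have cf := closure_map_of_tab.
rewrite [RHS]surjective_pairing /tab_of_map; congr pair.
  apply: eq_from_tnth => i; rewrite tnth_mktuple.
  have <- : isrow T i = tnth T.1 i by rewrite /isrow ltn_ord (tnth_nth false).
  apply/forallP/idP => [h|ri k].
    apply/negPn/negP => nri.
    have ci : iscol T i by move: nri; rewrite /isrow /iscol ltn_ord.
    have [k fk kt] := map_of_tab_top ci; have := h k.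
    by rewrite fk eqxx kt (top_lt ptT ci).
  apply/implyP => ki; apply/eqP => fk; case: (map_of_tab_one k) => [E|].
    by move: ki; rewrite -fk E ltnn.
  by rewrite fk => /one_cell[_ ]; rewrite iscolN.
apply/ffunP => -[a b]; rewrite ffunE /= -fl_ord.
apply/andP/idP => [[/andP[ab bf] /existsP[k /andP[ka /eqP fk]]]|flab].
  have ob : k < b -> one T k b.
    by move=> kb; case: (map_of_tab_one k); rewrite fk // => E; move: kb; rewrite E ltnn.
  have {}ob := ob (leq_ltn_trans ka ab).
  have oa : one T a (f a).
    by case: (map_of_tab_one a) => // E; move: bf; rewrite E leqNgt ab.
  have [ra _ _] := one_cell oa; have [_ cb _] := one_cell ob.
  move: bf; rewrite leq_eqVlt => /predU1P[E|bf]; first by rewrite E; case/andP: oa.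
  have cab : cell T a b by rewrite /cell ra cb.
  move: ka; rewrite leq_eqVlt => /predU1P[E|ka]; first by rewrite -E; case/andP: ob.
  (* A 0 here would be restricted by the 1 in [(k, b)], against the 1 to its left in [(a, f a)]. *)
  have := cell_below_top ptT cab (leq_ltn_trans (top_min ob) ka).
  case/orP=> [/andP[] //|r0]; have := restr0_lt ptT r0 oa.
  by rewrite ltnNge (ltnW bf).
have cab : cell T a b.
  apply: contraTT flab => nc; rewrite fl_ord; case/andP: ptT => /forallP/(_ a).
  by move=> /forallP/(_ b); rewrite nc.
have oab : one T a b by rewrite /one cab.
have [_ cb ab] := one_cell oab; rewrite ab map_of_tab_max //; split=> //.
(* The witness is the row of the topmost 1 of column [b]. *)
have [k fk kt] := map_of_tab_top cb.
by apply/existsP; exists k; rewrite fk eqxx kt top_min.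
Qed.

End MapOfTab.

(** * Closure maps and set partitions *)

Lemma card_cancel_in (aT rT : finType) (A : {set aT}) (B : {set rT})
    (f : aT -> rT) (g : rT -> aT) :
  {in A, forall x, f x \in B} -> {in B, forall y, g y \in A} ->
  {in A, cancel f g} -> {in B, cancel g f} -> #|A| = #|B|.
Proof.
move=> fB gA fK gK; rewrite -(card_in_imset (can_in_inj fK)); apply: eq_card => y.
apply/imsetP/idP => [[x xA ->]|yB]; first exact: fB.
by exists (g y); rewrite ?gA ?gK.
Qed.

Definition block_max n (P : {set {set 'I_n}}) : {ffun 'I_n -> 'I_n} :=
  [ffun i : 'I_n => [arg max_(j > i in pblock P i) nat_of_ord j]].

Lemma block_maxP n (P : {set {set 'I_n}}) i : partition P [set: 'I_n] ->
  block_max P i \in pblock P i /\ (forall j, j \in pblock P i -> j <= block_max P i).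
Proof.
move=> pP; rewrite ffunE; case: arg_maxnP => [|j jP max]; last by split.
by rewrite mem_pblock (cover_partition pP).
Qed.

(** The maximum lies in its block and therefore determines it. *)
Lemma block_max_eq n (P : {set {set 'I_n}}) i j : partition P [set: 'I_n] ->
  (block_max P i == block_max P j) = (pblock P i == pblock P j).
Proof.
move=> pP; have /and3P[_ tP _] := pP.
have [iP imax] := block_maxP i pP; have [jP jmax] := block_maxP j pP.
apply/eqP/eqP => h; first by rewrite -(same_pblock tP iP) h (same_pblock tP jP).
by apply/val_inj/eqP; rewrite eqn_leq jmax ?imax // -?h // h.
Qed.

(** A map goes to the partition into its fibres, a partition to its block maxima. *)
Lemma card_closure_map n : #|[set f : {ffun 'I_n -> 'I_n} | closure_map f]| = bell n.
Proof.
rewrite /bell.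
apply: (card_cancel_in (f := fun f : {ffun 'I_n -> 'I_n} => preim_partition f [set: 'I_n])
                       (g := @block_max n)).
- by move=> f _; rewrite inE preim_partitionP.
- move=> P; rewrite !inE => pP; have := pP => /and3P[_ tP _].
  apply/closure_mapP; split=> i.
    have [_] := block_maxP i pP; apply.
    by rewrite mem_pblock (cover_partition pP).
  have [iP _] := block_maxP i pP.
  by apply/eqP; rewrite block_max_eq // (same_pblock tP iP).
- move=> f; rewrite inE => /closure_mapP[ge idem]; apply/ffunP => i.
  have pP := preim_partitionP f [set: 'I_n].
  have mem j : (j \in pblock (preim_partition f [set: 'I_n]) i) = (f i == f j).
    rewrite pblock_equivalence_partition ?inE // => x y z _ _ _.
    by split=> // /eqP->.
  (* [f i] lies in the fibre of [i] by idempotence, and bounds it because [j <= f j]. *)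
  have [] := block_maxP i pP; rewrite mem => /eqP E max.
  apply/val_inj/eqP; rewrite eqn_leq max ?mem ?idem ?eqxx // andbT.
  by rewrite E ge.
move=> P; rewrite inE => pP; rewrite -[RHS](preim_partition_pblock pP).
by apply: eq_imset => x; apply/setP => y; rewrite !inE block_max_eq.
Qed.

Theorem theorem3p2 (n : nat) :
  1 <= n ->
  #|[set T : tab n | is_perm_tableau T && (pt_inv T == 0)]| = bell n.
Proof.
move=> _; rewrite -card_closure_map.
apply: (@card_cancel_in _ _ _ _ (@map_of_tab n) (@tab_of_map n)) => [T|f|T|f]; rewrite !inE.
- by case/andP=> pT; rewrite pt_inv_eq0 // => lt; apply: closure_map_of_tab.
- move=> cf; rewrite is_perm_tab_of_map // pt_inv_eq0 ?is_perm_tab_of_map //.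
  exact: leading_tops_tab_of_map.
- by case/andP=> pT; rewrite pt_inv_eq0 // => lt; apply: map_of_tabK.
exact: tab_of_mapK.
Qed.
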